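(* Let $(N_{II}(t))_{t\in\mathbb{N}_0}$ be a recurrent (type II) discrete-time renewal process, and let $\Delta T$ be a stopping time with values in $\mathbb{N}$, independent of $N_{II}$ and non-defective, with $\psi_S(r)=\mathbb{P}[\Delta T=r]$, $\sum_{r\ge 1}\psi_S(r)=1$. Let $$M(t)=\Theta(\Delta T-1-t)\,N_{II}(t)+\Theta(t-\Delta T)\,N_{II}(\Delta T),\qquad t\in\mathbb{N}_0 .$$ Then for all $m,t\in\mathbb{N}_0$, $$\mathbb{P}[M(t)=m]=\Phi_S^{(0)}(t)\,\Phi_{II}^{(m)}(t)+\sum_{r=1}^{t}\psi_S(r)\,\Phi_{II}^{(m)}(r)=\sum_{r=1}^{\infty}\psi_S(r)\Big(\Phi_{II}^{(m)}(t)\,\Theta(r-t-1)+\Phi_{II}^{(m)}(r)\,\Theta(t-r)\Big),$$ where $\Phi_{II}^{(m)}(r)=\mathbb{P}[N_{II}(r)=m]$ and $\Phi_S^{(0)}(t)=\mathbb{P}[\Delta T>t]$.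
   Context: $\mathbb{N}=\{1,2,\dots\}$, $\mathbb{N}_0=\{0,1,2,\dots\}$. $\Theta$ is the discrete Heaviside function on $\mathbb{Z}$: $\Theta(r)=1$ for $r\ge 0$ (in particular $\Theta(0)=1$) and $\Theta(r)=0$ for $r<0$. A recurrent (type II) discrete-time renewal process is $N_{II}(t)=\max\{n\ge 0: J_n\le t\}$, where $J_0=0$, $J_n=\sum_{j=1}^n\Delta t_j$, and the waiting times $\Delta t_j$ are IID, $\mathbb{N}$-valued and almost surely finite (non-defective), so that $N_{II}(0)=0$. The process $M$ equals $N_{II}(t)$ for $t<\Delta T$ and is frozen at the value $N_{II}(\Delta T)$ for $t\ge\Delta T$. An empty sum is zero. *)

(* Defs.v *)
From HB Require Import structures.
From mathcomp Require Import all_boot all_order all_algebra finmap.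
From mathcomp Require Import all_classical all_reals all_analysis.

Set Implicit Arguments.
Unset Strict Implicit.
Unset Printing Implicit Defensive.
Import Order.TTheory GRing.Theory Num.Theory.
Local Open Scope classical_set_scope.
Local Open Scope ring_scope.
Local Open Scope ereal_scope.

Definition Theta (r : int) : nat := if (0 <= r)%R then 1%N else 0%N.

(* Maximum of a set of natural numbers; the value 0 is junk when there is no
   maximum. *)
Definition max_nat (A : set nat) : nat := xget 0%N (A `&` ubound A).

Section Renewal.
Context {d : measure_display} {T : measurableType d} {R : realType}.
Variable P : probability T R.

(* X is a random variable with values in {1, 2, ...} and is non-defective. *)
Definition positive_nondefective (X : {RV P >-> nat}) : Prop :=
  (forall w, (1 <= X w)%N) /\
  \sum_(1 <= r <oo) P [set w | X w = r] = 1.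

Definition mutually_independent (X : nat -> {RV P >-> nat}) : Prop :=
  forall (I : {fset nat}) (A : nat -> set nat),
    (forall i, measurable (A i)) ->
    P (\bigcap_(i in [set` I]) (X i @^-1` A i)) =
    \prod_(i <- I) P (X i @^-1` A i).

Definition identically_distributed (X : nat -> {RV P >-> nat}) : Prop :=
  forall i j (A : set nat), measurable A ->
    distribution P (X i) A = distribution P (X j) A.

(* dt j is the (j+1)-st waiting time. *)
Definition renewal_waiting_times (dt : nat -> {RV P >-> nat}) : Prop :=
  [/\ mutually_independent dt,
      identically_distributed dt &
      forall j, positive_nondefective (dt j)].

Definition arrival (dt : nat -> {RV P >-> nat}) (n : nat) (w : T) : nat :=
  (\sum_(j < n) dt j w)%N.

Definition renewal_process (dt : nat -> {RV P >-> nat}) (t : nat) (w : T) : nat :=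
  max_nat [set n | (arrival dt n w <= t)%N].

Definition process_sigma_algebra (X : nat -> T -> nat) : set (set T) :=
  <<s \bigcup_t preimage_set_system setT (X t) measurable >>.

Definition independent_of_process (Y : {RV P >-> nat}) (X : nat -> T -> nat) :
    Prop :=
  forall A B : set T,
    preimage_set_system setT Y measurable A -> process_sigma_algebra X B ->
    P (A `&` B) = P A * P B.

Definition stopped_process (N : nat -> T -> nat) (DT : T -> nat)
    (t : nat) (w : T) : nat :=
  (Theta ((DT w)%:Z - 1 - t%:Z)%R * N t w +
   Theta (t%:Z - (DT w)%:Z)%R * N (DT w) w)%N.

Definition state_prob (N : nat -> T -> nat) (m r : nat) : \bar R :=
  P [set w | N r w = m].

Definition pmf_nat (X : T -> nat) (r : nat) : \bar R := P [set w | X w = r].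

Definition survival (X : T -> nat) (t : nat) : \bar R :=
  P [set w | (t < X w)%N].

End Renewal.

(* Main.v *)
(** One has [M t = N_II (min DT t)] pointwise. Partitioning according to
    the value of [DT] and using independence gives
    [P (M t = m) = \sum_(r >= 1) psi_S r * Phi_II m (min r t)]; both right-hand
    sides are this series, split at [r = t]. *)
Require Import Defs.
From mathcomp Require Import all_boot all_order all_algebra.
From mathcomp Require Import all_classical all_reals all_analysis.
From mathcomp Require Import zify.
Import Order.TTheory GRing.Theory Num.Theory.
Local Open Scope classical_set_scope.
Local Open Scope ring_scope.
Local Open Scope ereal_scope.

(** Countable additivity over the level sets of [X]; levels below [n] do not meet [A], so the series
    may start at [n]. *)
Lemma measure_nat_partition (R : realType) (d : measure_display)
    (T : measurableType d) (mu : {measure set T -> \bar R}) (X : T -> nat)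
    (n : nat) (A : set T) :
  measurable A -> (forall r, measurable [set w | X w = r]) ->
  (forall w, A w -> (n <= X w)%N) ->
  mu A = \sum_(n <= r <oo) mu ([set w | X w = r] `&` A).
Proof.
move=> mA mX nX; rewrite eseries_cond.
transitivity (mu (\bigcup_(r in [set` [pred k | (n <= k)%N]])
    ([set w | X w = r] `&` A))).
  congr (mu _); apply/seteqP; split => [w Aw|w [r _ []]//].
  by exists (X w) => //=; exact: nX.
rewrite measure_bigcup.
- by apply: congr_lim; apply/funext => k; apply: eq_bigl => i; rewrite mem_setE.
- by move=> r _; exact: measurableI.
- by move=> i j _ _ [w [[<- _] [<- _]]].
Qed.

Section renewal.
Context {R : realType} {d : measure_display} {T : measurableType d}.
Variables (P : probability T R) (dt : nat -> {RV P >-> nat}).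
Hypothesis dt_gt0 : forall j w, (1 <= dt j w)%N.

Lemma arrivalS n w : arrival dt n.+1 w = (arrival dt n w + dt n w)%N.
Proof. by rewrite /arrival big_ord_recr. Qed.

Lemma arrival_lt w : {homo (fun n => arrival dt n w) : m n / (m < n)%N}.
Proof.
apply: homo_ltn; first exact: ltn_trans.
by move=> n; rewrite arrivalS -[ltnLHS]addn0 ltn_add2l dt_gt0.
Qed.

(** Waiting times are at least 1, so arrivals strictly increase and exactly one index [k] satisfies
    [arrival k <= t < arrival k.+1]. The maximum is thus attained for every [w], and the junk value
    of [max_nat] never intervenes. *)
Lemma renewal_process_eqP t m w :
  renewal_process dt t w = m <->
  (arrival dt m w <= t)%N /\ (t < arrival dt m.+1 w)%N.
Proof.
have mono := leqW_mono (le_mono (arrival_lt w)).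
have uniqm k : (arrival dt k w <= t)%N -> (t < arrival dt k.+1 w)%N ->
    renewal_process dt t w = k.
  move=> kt tk; apply: xget_unique.
    split => //= n /= nt.
    by have := leq_ltn_trans nt tk; rewrite mono ltnS.
  move=> n [/= nt un]; have kn : (k <= n)%N := un k kt.
  apply/eqP; rewrite eqn_leq kn andbT.
  by have := leq_ltn_trans nt tk; rewrite mono ltnS.
split; last by case; exact: uniqm.
suff [k [kt tk]] : exists k, (arrival dt k w <= t)%N /\
    (t < arrival dt k.+1 w)%N by rewrite (uniqm k kt tk) => <-.
(* This bounds by [t] every index whose arrival is at most [t], so a largest one exists. *)
have arr_ge n : (n <= arrival dt n w)%N.
  by elim: n => // n ih; exact: leq_ltn_trans ih (arrival_lt w _ _ (ltnSn n)).
have ex0 : exists n, (arrival dt n w <= t)%N by exists 0%N; rewrite /arrival big_ord0.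
have bnd n : (arrival dt n w <= t)%N -> (n <= t)%N by exact: leq_trans.
have [k kt maxk] := ex_maxnP ex0 bnd.
by exists k; split=> //; rewrite ltnNge; apply/negP => /maxk; rewrite ltnn.
Qed.

Lemma measurable_renewal_process t m :
  measurable [set w | renewal_process dt t w = m].
Proof.
have mA n : measurable_fun setT (arrival dt n).
  elim: n => [|n ih].
    rewrite (_ : arrival dt 0 = cst 0%N) //.
    by apply/funext => w; rewrite /arrival big_ord0.
  rewrite (funext (arrivalS n)).
  exact: measurable_realfun.measurable_fun_addn.
have -> : [set w | renewal_process dt t w = m] =
    arrival dt m @^-1` [set k | (k <= t)%N] `&`
    arrival dt m.+1 @^-1` [set k | (t < k)%N].
  by apply/seteqP; split => w /= /renewal_process_eqP.
apply: measurableI; rewrite -[X in measurable X]setTI; exact: mA.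
Qed.

Lemma independent_renewal_process (DT : {RV P >-> nat}) r s m :
  independent_of_process DT (renewal_process dt) ->
  P ([set w | DT w = r] `&` [set w | renewal_process dt s w = m]) =
  pmf_nat P DT r * state_prob P (renewal_process dt) m s.
Proof.
apply; first by exists [set r] => //; rewrite setTI.
by apply: sub_sigma_algebra; exists s => //; exists [set m] => //; rewrite setTI.
Qed.

End renewal.

Lemma ThetaE (r : int) : Theta r = (0 <= r)%R.
Proof. by rewrite /Theta; case: ifP. Qed.

(** The first Heaviside factor is 1 iff [t < DT w], the second iff [DT w <= t], so exactly one
    summand survives. As [Theta 0 = 1], the shift by 1 prevents double counting at [t = DT w]. *)
Lemma stopped_processE (d : measure_display) (T : measurableType d)
    (N : nat -> T -> nat) (DT : T -> nat) t w :
  stopped_process N DT t w = N (minn (DT w) t) w.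
Proof.
rewrite /stopped_process !ThetaE.
have -> : (0 <= (DT w)%:Z - 1 - t%:Z)%R = (t < DT w)%N by lia.
have -> : (0 <= t%:Z - (DT w)%:Z)%R = (DT w <= t)%N by lia.
by case: leqP => _; rewrite mul0n mul1n ?addn0.
Qed.

Theorem theorem4p5 (R : realType) (d : measure_display) (T : measurableType d)
  (P : probability T R)
  (dt : nat -> {RV P >-> nat}) (DT : {RV P >-> nat})
  (hdt : renewal_waiting_times dt)
  (hDT : positive_nondefective DT)
  (hind : independent_of_process DT (renewal_process dt)) :
  let N_II := renewal_process dt in
  let M := stopped_process N_II DT in
  let psi_S := pmf_nat P DT in
  let PhiS0 := survival P DT in
  let PhiII := state_prob P N_II in
  forall m t : nat,
    P [set w | M t w = m] =
      PhiS0 t * PhiII m t + \sum_(1 <= r < t.+1) psi_S r * PhiII m r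
    /\
    PhiS0 t * PhiII m t + \sum_(1 <= r < t.+1) psi_S r * PhiII m r =
      \sum_(1 <= r <oo)
        psi_S r * (PhiII m t * (Theta (r%:Z - t%:Z - 1)%R)%:R%:E
                   + PhiII m r * (Theta (t%:Z - r%:Z)%R)%:R%:E).
Proof.
move=> N M psi PhiS0 Phi m t.
have dt0 j w : (1 <= dt j w)%N by case: hdt => _ _ /(_ j) [].
have DT1 : forall w, (1 <= DT w)%N by case: hDT.
have mDT A : measurable [set w | A (DT w)].
  by rewrite -[X in measurable X]setTI; exact: (measurable_funP DT).
have mN s := measurable_renewal_process _ _ dt0 s m.
(* Fixing [DT = r] makes the time index deterministic, which is what lets independence apply. *)
have atDT r : [set w | DT w = r] `&` [set w | M t w = m] =
    [set w | DT w = r] `&` [set w | N (minn r t) w = m].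
  by apply/seteqP; split => w /= [<-]; rewrite /M stopped_processE.
have mM : measurable [set w | M t w = m].
  have -> : [set w | M t w = m] =
      \bigcup_r ([set w | DT w = r] `&` [set w | N (minn r t) w = m]).
    apply/seteqP; split => [w Mw|w [r _]]; last by rewrite -atDT => -[].
    by exists (DT w) => //; rewrite -atDT.
  by apply: bigcupT_measurable => r; apply: measurableI => //; exact: (mDT (eq^~ r)).
have PM : P [set w | M t w = m] =
    \sum_(1 <= r <oo) psi r * Phi m (minn r t).
  rewrite (measure_nat_partition _ _ _ P DT 1) //; last by move=> r; exact: (mDT (eq^~ r)).
  apply: eq_eseriesr => r _.
  by rewrite atDT; exact: independent_renewal_process.
have PhiS0E : PhiS0 t = \sum_(t.+1 <= r <oo) psi r.
  rewrite /PhiS0 /survival (measure_nat_partition _ _ _ P DT t.+1) //.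
  (* Moving the lower bound into the summation predicate makes [t < r] available termwise; [DT = r]
     then already implies [t < DT]. *)
  - rewrite eseries_cond [RHS]eseries_cond; apply: eq_eseriesr => r /= tr.
    by congr (P _); apply/seteqP; split => w /=; [case | move=> Dr; rewrite Dr].
  - exact: (mDT (fun k => t < k)%N).
  - by move=> r; exact: (mDT (eq^~ r)).
have split_sum : \sum_(1 <= r <oo) psi r * Phi m (minn r t) =
    PhiS0 t * Phi m t + \sum_(1 <= r < t.+1) psi r * Phi m r.
  (* The head runs over [1 <= r <= t], where the minimum is [r]; on the tail it is [t], so [Phi m t]
     factors out. *)
  rewrite (nneseries_split 1 t) => [|k _]; last exact: mule_ge0.
  rewrite addeC add1n; congr (_ + _); last first.
    apply: eq_big_nat => r; rewrite ltnS => /andP[_ rt].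
    by rewrite (minn_idPl rt).
  (* [nneseriesZl] pulls out a real scalar, and a probability is finite. *)
  have -> : Phi m t = (fine (Phi m t))%:E by rewrite fineK // fin_num_measure.
  rewrite muleC PhiS0E -nneseriesZl => [|//].
  rewrite eseries_cond [RHS]eseries_cond; apply: eq_eseriesr => r /= tr.
  by rewrite (minn_idPr (ltnW tr)) fineK ?fin_num_measure // muleC.
split; first by rewrite PM.
rewrite -split_sum.
(* Termwise, the two indicators [t < r] and [r <= t] select [Phi m (minn r t)]. *)
apply: eq_eseriesr => r _; congr (_ * _); rewrite !ThetaE.
have -> : (0 <= r%:Z - t%:Z - 1)%R = (t < r)%N by lia.
have -> : (0 <= t%:Z - r%:Z)%R = (r <= t)%N by lia.
by case: leqP => _; rewrite mule0 mule1 ?add0e ?adde0.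
Qed.
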